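(* Let $H$ be a finite dimensional hereditary algebra. Then for every $\mathcal{T}\in\mathrm{tors}_0 H$, $$\alpha(\bar\kappa(\mathcal{T}))=\epsilon(\alpha(\mathcal{T})),$$ i.e. the square formed by $\bar\kappa:\mathrm{tors}_0H\to\mathrm{tors}\,H$, $\epsilon:\mathrm{wide}\,H\to\mathrm{wide}\,H$, and the vertical maps given by $\alpha$ (from $\mathrm{tors}_0H$ and from $\mathrm{tors}\,H$ to $\mathrm{wide}\,H$) commutes.
   Context: Modules are finitely generated. A torsion class is a full subcategory of $\mathrm{mod}\,H$ closed under isomorphisms, quotients and extensions; $\mathrm{tors}\,H$ is the complete lattice of torsion classes ordered by inclusion (meet is intersection). A wide subcategory is a full subcategory of $\mathrm{mod}\,H$ closed under extensions, kernels and cokernels; $\mathrm{wide}\,H$ is the collection of these. A brick is a module whose endomorphism ring is a division ring. $\mathrm{Gen}(M)$ is the class of quotients of finite direct sums of copies of $M$; $\mathrm{Filt}(\mathcal{C})$ is the class of modules with a finite filtration with successive quotients in $\mathcal{C}$; $\mathcal{T}_M=\mathrm{Filt}(\mathrm{Gen}(M))$. A join representation $x=\bigvee A$ in a lattice $L$ is irredundant if $\bigvee A'<x$ for each proper subset $A'\subsetneq A$; $\bigvee A$ is lower than $\bigvee B$ if for each $a\in A$ there is $b\in B$ with $a\le b$. The canonical join representation $\mathrm{CJR}(x)$ is the unique lowest irredundant join representation among all irredundant ones of $x$, when it exists. $\mathrm{tors}_0H$ is the set of torsion classes $\mathcal{T}$ having a canonical join representation of the form $\mathrm{CJR}(\mathcal{T})=\bigvee_{\alpha\in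 A}\mathcal{T}_{M_\alpha}$ with $\{M_\alpha\}_{\alpha\in A}$ a set of bricks. An element $j$ is completely join-irreducible if $j=\bigvee A$ implies $j\in A$; then $j_*$ denotes the unique element covered by $j$, and $\kappa(j)$ is the unique maximum of $\{x\in L: j_*\le x,\ j\not\le x\}$, when it exists. If $x$ has a canonical join representation such that $\kappa(j)$ is defined for each $j\in\mathrm{CJR}(x)$ (and the meet exists), then $\bar\kappa(x):=\bigwedge\{\kappa(j):j\in\mathrm{CJR}(x)\}$. Here $L=\mathrm{tors}\,H$; $\bar\kappa$ is defined on $\mathrm{tors}_0H$. $\alpha:\mathrm{tors}\,H\to\mathrm{wide}\,H$ is $\alpha(\mathcal{T})=\{X\in\mathcal{T}: \ker(g)\in\mathcal{T}\text{ for every morphism } g:Y\to X \text{ with } Y\in\mathcal{T}\}$. $\epsilon:\mathrm{wide}\,H\to\mathrm{wide}\,H$ is $\epsilon(\mathcal{W})={}^{\perp_{0,1}}\mathcal{W}=\{X\in\mathrm{mod}\,H:\mathrm{Hom}_H(X,M)=0=\mathrm{Ext}^1_H(X,M)\ \text{for all } M\in\mathcal{W}\}$. *)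

(* Defs.v *)
(* Classes of modules are bare predicates rather than [classical_sets.set]s,
   whose universe lies strictly below that of [lmodType]. *)
From HB Require Import structures.
From mathcomp Require Import all_boot all_order all_algebra all_field.
From mathcomp Require Import boolp.

Set Implicit Arguments.
Unset Strict Implicit.
Unset Printing Implicit Defensive.

Import GRing.Theory.
Local Open Scope ring_scope.

Section Lattice.
(* Joins and meets are relational: [is_join A x] reads "the join of A exists and
   is x".  Every instance below has an antisymmetric [le]. *)
Variables (L : Type) (le : L -> L -> Prop).

Definition is_join (A : L -> Prop) (x : L) : Prop :=
  (forall a, A a -> le a x) /\
  (forall y, (forall a, A a -> le a y) -> le x y).

Definition is_meet (A : L -> Prop) (x : L) : Prop :=
  (forall a, A a -> le x a) /\
  (forall y, (forall a, A a -> le y a) -> le y x).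

Definition strictly_below (x y : L) : Prop := le x y /\ x <> y.

Definition irredundant_join_rep (x : L) (A : L -> Prop) : Prop :=
  is_join A x /\
  (forall A' : L -> Prop,
     (forall a, A' a -> A a) -> (exists2 a, A a & ~ A' a) ->
     forall y, is_join A' y -> strictly_below y x).

Definition lower (A B : L -> Prop) : Prop :=
  forall a, A a -> exists2 b, B b & le a b.

(* Irredundant sets are antichains, so [lower] is antisymmetric on them and
   the lowest one is unique. *)
Definition is_CJR (x : L) (A : L -> Prop) : Prop :=
  irredundant_join_rep x A /\
  (forall B, irredundant_join_rep x B -> lower A B).

Definition completely_join_irreducible (j : L) : Prop :=
  forall A, is_join A j -> A j.

Definition covered_by (x y : L) : Prop :=
  strictly_below x y /\ (forall z, ~ (strictly_below x z /\ strictly_below z y)).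

Definition is_lower_star (j js : L) : Prop :=
  covered_by js j /\ (forall z, covered_by z j -> z = js).

Definition is_max (A : L -> Prop) (m : L) : Prop :=
  A m /\ (forall x, A x -> le x m).

Definition is_kappa (j m : L) : Prop :=
  completely_join_irreducible j /\
  (exists2 js, is_lower_star j js & is_max (fun x => le js x /\ ~ le j x) m).

Definition is_kappa_bar (x m : L) : Prop :=
  exists2 A, is_CJR x A &
    (forall j, A j -> exists k, is_kappa j k) /\
    is_meet (fun k => exists2 j, A j & is_kappa j k) m.

End Lattice.

Section Modules.
Variables (K : fieldType) (H : falgType K).

Definition surjective (X Y : Type) (f : X -> Y) : Prop :=
  forall y, exists x, f x = y.

Definition finitely_generated (M : lmodType H) : Prop :=
  exists (n : nat) (e : 'I_n -> M),
    forall x, exists c : 'I_n -> H, x = \sum_i c i *: e i.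

Record fgmod := FGMod {
  fgmod_sort :> lmodType H;
  fgmodP : finitely_generated fgmod_sort
}.

Definition mod_class : Type := fgmod -> Prop.

Definition projective (P : lmodType H) : Prop :=
  forall (X Y : lmodType H) (g : {linear X -> Y}) (f : {linear P -> Y}),
    surjective g -> exists h : {linear P -> X}, forall x, g (h x) = f x.

(* Left ideals are the modules embedding into the regular module [H^o]. *)
Definition hereditary : Prop :=
  forall (I : lmodType H) (i : {linear I -> H^o}), injective i -> projective I.

(* Kernels and cokernels are given by any representative, so that closure under
   them includes closure under isomorphism. *)
Definition is_kernel (N X Y : lmodType H)
    (i : {linear N -> X}) (f : {linear X -> Y}) : Prop :=
  injective i /\ (forall x, f x = 0 <-> exists n, i n = x).

Definition is_cokernel (X Y C : lmodType H)
    (f : {linear X -> Y}) (p : {linear Y -> C}) : Prop :=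
  surjective p /\ (forall y, p y = 0 <-> exists x, f x = y).

Definition short_exact (X Y Z : lmodType H)
    (i : {linear X -> Y}) (p : {linear Y -> Z}) : Prop :=
  is_kernel i p /\ surjective p.

Definition iso_closed (C : mod_class) : Prop :=
  forall (X Y : fgmod) (f : {linear X -> Y}), bijective f -> C X -> C Y.

Definition quotient_closed (C : mod_class) : Prop :=
  forall (X Y : fgmod) (f : {linear X -> Y}), surjective f -> C X -> C Y.

Definition extension_closed (C : mod_class) : Prop :=
  forall (X Y Z : fgmod) (i : {linear X -> Y}) (p : {linear Y -> Z}),
    short_exact i p -> C X -> C Z -> C Y.

Definition kernel_closed (C : mod_class) : Prop :=
  forall (X Y : fgmod) (f : {linear X -> Y}), C X -> C Y ->
    forall (N : fgmod) (i : {linear N -> X}), is_kernel i f -> C N.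

Definition cokernel_closed (C : mod_class) : Prop :=
  forall (X Y : fgmod) (f : {linear X -> Y}), C X -> C Y ->
    forall (Q : fgmod) (p : {linear Y -> Q}), is_cokernel f p -> C Q.

(* Nonemptiness puts the zero module in the class; without it, the empty class
   would satisfy the closure conditions. *)
Definition torsion_class (C : mod_class) : Prop :=
  [/\ (exists X, C X), iso_closed C, quotient_closed C & extension_closed C].

Definition wide_subcategory (C : mod_class) : Prop :=
  [/\ (exists X, C X), extension_closed C, kernel_closed C & cokernel_closed C].

Record tors := Tors {
  tors_class :> fgmod -> Prop;
  torsP : torsion_class tors_class
}.

Definition tors_le (T U : tors) : Prop := forall X, T X -> U X.

Lemma tors_le_anti (T U : tors) : tors_le T U -> tors_le U T -> T = U.
Proof.
case: T U => [C hC] [D hD] CD DC.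
have E : C = D by apply/funext => X; apply/propext; split; [apply: CD|apply: DC].
by subst D; congr Tors; apply: Prop_irrelevance.
Qed.

Definition brick (M : fgmod) : Prop :=
  ~ (forall x : M, x = 0) /\
  (forall f : {linear M -> M}, ~ (forall x, f x = 0) ->
     exists g : {linear M -> M}, cancel f g /\ cancel g f).

Definition Gen (M : fgmod) : mod_class :=
  fun X => exists (n : nat) (f : {linear {ffun 'I_n -> M} -> X}), surjective f.

Inductive Filt (C : mod_class) : mod_class :=
| Filt_zero (X : fgmod) : (forall x : X, x = 0) -> Filt C X
| Filt_step (X Y Z : fgmod) (i : {linear X -> Y}) (p : {linear Y -> Z}) :
    short_exact i p -> Filt C X -> C Z -> Filt C Y.

Definition tors_gen (M : fgmod) : mod_class := Filt (Gen M).

Definition tors0 (T : tors) : Prop :=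
  exists2 A, is_CJR tors_le T A &
     forall j, A j -> exists2 M, brick M & (forall X, j X <-> tors_gen M X).

Definition alpha (T : tors) : mod_class :=
  fun X => T X /\
     (forall (Y : fgmod) (g : {linear Y -> X}), T Y ->
        forall (N : fgmod) (i : {linear N -> Y}), is_kernel i g -> T N).

Definition Hom_zero (X M : fgmod) : Prop :=
  forall (f : {linear X -> M}) (x : X), f x = 0.

(* Ext^1 is Yoneda's: classes of short exact sequences 0 -> M -> E -> X -> 0.
   It vanishes when each is equivalent, by a map [phi] commuting with the
   identities of M and X, to the trivial extension by M x X. *)
Definition Ext1_zero (X M : fgmod) : Prop :=
  forall (E : fgmod) (i : {linear M -> E}) (p : {linear E -> X}),
    short_exact i p ->
    exists phi : {linear E -> (M * X)%type},
      (forall m, phi (i m) = (m, 0)) /\ (forall e, (phi e).2 = p e).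

Definition epsilon_wide (W : mod_class) : mod_class :=
  fun X => forall M, W M -> Hom_zero X M /\ Ext1_zero X M.

End Modules.

(* Main.v *)
(* Let [S] be the set of bricks of the canonical join representation of [T].
   Being the lowest representation forces [S] to be a semibrick, and then every
   nonzero map from a module of [T] to a brick [M] of [S] is surjective with
   kernel in [T].  Hence [M] is a simple object of [W = alpha T], and [W] is
   filtered by [S].  The torsion class of a brick [M] is completely join
   irreducible with [kappa] equal to the left perpendicular class of [M], so
   [kappa_bar T] is the left perpendicular class [U] of [S], that is, of [W].
   Finally [alpha U] consists of the [X] in [U] with [Ext^1(X, W) = 0].  If
   [Ext^1(X, M) = 0] for [M] in [W] and [N] is the kernel of [Y -> X] with [Y]
   in [U], heredity gives [Ext^1(I, M) = 0] for the image [I] of [Y], and so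
   [Hom(N, M) = 0].
   Conversely, in a nonsplit extension [E] of [X] in [U] by [M] in [S] the module [E]
   lies in [U], because a map from [E] to [W] not vanishing on [M] would split
   it; since [M], the kernel of [E -> X], is not in [U], [X] is not in
   [alpha U]. *)
Require Import Defs.
From HB Require Import structures.
From mathcomp Require Import all_boot all_order all_algebra all_field.
From mathcomp Require Import boolp.

Set Implicit Arguments.
Unset Strict Implicit.
Unset Printing Implicit Defensive.

Import GRing.Theory.

(** * Submodules, quotient modules and the factorization of linear maps through them *)

Section SubQuotient.
Local Open Scope ring_scope.
Variables (R : pzRingType).
Implicit Types M X Y Q S : lmodType R.

Record submodule (M : lmodType R) := Submodule {
  submodule_pred :> M -> Prop;
  submodule0 : submodule_pred 0;
  submoduleP : forall a x y,
    submodule_pred x -> submodule_pred y -> submodule_pred (a *: x + y)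
}.

Lemma linear_exists X Y (f : X -> Y) :
  linear f -> exists g : {linear X -> Y}, forall x, g x = f x.
Proof.
move=> lf; pose fL := GRing.isLinear.Build R X Y *:%R f lf.
by exists (HB.pack_for {linear X -> Y} f fL).
Qed.

Section Submodule.
Variables (M : lmodType R) (N : submodule M).

Lemma submoduleB x y : N x -> N y -> N (x - y).
Proof. by move=> Nx Ny; rewrite addrC -scaleN1r; apply: submoduleP. Qed.

Lemma submoduleN x : N x -> N (- x).
Proof. by move=> Nx; rewrite -sub0r; apply: submoduleB => //; apply: submodule0. Qed.

Lemma submoduleD x y : N x -> N y -> N (x + y).
Proof. by move=> Nx Ny; rewrite -[x]scale1r; apply: submoduleP. Qed.

Lemma submoduleZ a x : N x -> N (a *: x).
Proof. by move=> Nx; rewrite -[_ *: _]addr0; apply: submoduleP => //; apply: submodule0. Qed.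

Definition submodule_mem : {pred M} := fun x => `[< N x >].

Lemma submodule_closed : GRing.submod_closed submodule_mem.
Proof.
split=> [|a x y /asboolP Nx /asboolP Ny]; first exact/asboolP/submodule0.
exact/asboolP/submoduleP.
Qed.

HB.instance Definition _ :=
  GRing.isSubmodClosed.Build R M submodule_mem
    (GRing.submod_closed_semi submodule_closed).

Definition sub_module := {x : M | x \in submodule_mem}.
HB.instance Definition _ := SubChoice.on sub_module.
HB.instance Definition _ := [SubChoice_isSubLmodule of sub_module by <:].

Lemma sub_exists : exists (S : lmodType R) (i : {linear S -> M}),
  injective i /\ (forall x, N x <-> exists n, i n = x).
Proof.
have [i iE] := @linear_exists sub_module M val (linearP _).
exists sub_module, i; split=> [x y|x]; first by rewrite !iE => /val_inj.
split=> [/asboolP Nx|[n <-]]; first by exists (Sub x Nx); rewrite iE.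
by rewrite iE; apply/asboolP/(valP n).
Qed.

(** One element is chosen in each coset, so that the quotient becomes the subtype of the chosen
    elements and inherits its choice structure from [M]. *)
Definition coset_repr (x : M) : M := choose (fun y => `[< N (y - x) >]) x.

Lemma coset_reprP x : N (coset_repr x - x).
Proof.
apply/asboolP; apply: (@chooseP _ (fun y => `[< N (y - x) >]) x).
by apply/asboolP; rewrite subrr; apply: submodule0.
Qed.

Lemma coset_repr_eq x y : N (x - y) -> coset_repr x = coset_repr y.
Proof.
move=> Nxy; rewrite /coset_repr.
(* The predicates for [x] and [y] agree because [N (x - y)]; [choose_id] then removes the dependence
   on the default value. *)
rewrite (@eq_choose _ _ (fun z => `[< N (z - y) >])).
  by apply: choose_id; apply/asboolP; rewrite ?subrr //; apply: submodule0.
move=> z; apply/asboolP/asboolP => Nz.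
  by rewrite -[z](subrK x) -addrA; apply: submoduleD.
by rewrite -[z](subrK y) -addrA; apply: submoduleD => //; rewrite -opprB; apply: submoduleN.
Qed.

Lemma coset_repr_id x : coset_repr (coset_repr x) = coset_repr x.
Proof. exact/coset_repr_eq/coset_reprP. Qed.

Definition quotient_module := {x : M | coset_repr x == x}.
HB.instance Definition _ := SubChoice.on quotient_module.

Definition class_of (x : M) : quotient_module :=
  exist _ (coset_repr x) (introT eqP (coset_repr_id x)).

Lemma class_of_eq x y : N (x - y) -> class_of x = class_of y.
Proof. by move=> Nxy; apply: val_inj; apply: coset_repr_eq. Qed.

Lemma class_of_val q : class_of (val q) = q.
Proof. by apply: val_inj; apply/eqP/(valP q). Qed.

Lemma val_class_of x : N (val (class_of x) - x).
Proof. exact: coset_reprP. Qed.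

Let add (q r : quotient_module) := class_of (val q + val r).
Let opp (q : quotient_module) := class_of (- val q).
Let scale a (q : quotient_module) := class_of (a *: val q).

Let addE x y : add (class_of x) (class_of y) = class_of (x + y).
Proof.
by apply: class_of_eq; rewrite opprD addrACA; apply: submoduleD; apply: val_class_of.
Qed.

Let scaleE a x : scale a (class_of x) = class_of (a *: x).
Proof.
by apply: class_of_eq; rewrite -scalerBr; apply: submoduleZ; apply: val_class_of.
Qed.

Let oppE x : opp (class_of x) = class_of (- x).
Proof.
by apply: class_of_eq; rewrite -opprD; apply: submoduleN; apply: val_class_of.
Qed.

Let classP (P : quotient_module -> Prop) : (forall x, P (class_of x)) -> forall q, P q.
Proof. by move=> h q; rewrite -(class_of_val q). Qed.

Fact quo_addA : associative add.
Proof.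
elim/classP => x; elim/classP => y; elim/classP => z.
by rewrite !addE addrA.
Qed.
Fact quo_addC : commutative add.
Proof. by elim/classP => x; elim/classP => y; rewrite !addE addrC. Qed.
Fact quo_add0 : left_id (class_of 0) add.
Proof. by elim/classP => x; rewrite addE add0r. Qed.
Fact quo_addN : left_inverse (class_of 0) opp add.
Proof. by elim/classP => x; rewrite oppE addE addNr. Qed.

HB.instance Definition _ :=
  GRing.isZmodule.Build quotient_module quo_addA quo_addC quo_add0 quo_addN.

Let addqE x y : class_of x + class_of y = class_of (x + y).
Proof. exact: addE. Qed.

Fact quo_scaleA a b q : scale a (scale b q) = scale (a * b) q.
Proof. by move: q; elim/classP => x; rewrite !scaleE scalerA. Qed.
Fact quo_scale1 : left_id 1 scale.
Proof. by elim/classP => x; rewrite scaleE scale1r. Qed.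
Fact quo_scaleDr : right_distributive scale +%R.
Proof. by move=> a; elim/classP => x; elim/classP => y; rewrite addqE !scaleE addqE scalerDr. Qed.
Fact quo_scaleDl q : {morph scale^~ q : a b / a + b}.
Proof. by move: q; elim/classP => x a b; rewrite !scaleE addqE scalerDl. Qed.

HB.instance Definition _ :=
  GRing.Zmodule_isLmodule.Build R quotient_module
    quo_scaleA quo_scale1 quo_scaleDr quo_scaleDl.

Lemma quo_exists : exists (Q : lmodType R) (p : {linear M -> Q}),
  surjective p /\ (forall x, p x = 0 <-> N x).
Proof.
have lc : linear class_of by move=> a x y; rewrite -addE -scaleE.
have [p pE] := linear_exists lc.
exists quotient_module, p; split=> [q|x].
  by exists (val q); rewrite pE class_of_val.
rewrite pE; split=> [x0|Nx]; last by apply: class_of_eq; rewrite subr0.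
have := val_class_of x; rewrite x0 => h.
have := val_class_of 0; rewrite subr0 => h0.
by rewrite -[x](subKr (val (class_of 0))); apply: submoduleB.
Qed.

End Submodule.

Lemma lin_factor X Q Y (p : {linear X -> Q}) (f : {linear X -> Y}) :
  surjective p -> (forall x, p x = 0 -> f x = 0) ->
  exists g : {linear Q -> Y}, forall x, g (p x) = f x.
Proof.
move=> sp k.
have [s sE] := choice sp.
have gE x : f (s (p x)) = f x.
  by apply/eqP; rewrite -subr_eq0 -linearB k // linearB sE subrr.
have lg : linear (f \o s).
  move=> a x y /=; rewrite -{1}[x]sE -{1}[y]sE -linearP gE.
  by rewrite linearP.
by have [g gE'] := linear_exists lg; exists g => x; rewrite gE' /= gE.
Qed.

Lemma lin_lift X S Y (i : {linear S -> X}) (f : {linear Y -> X}) :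
  injective i -> (forall y, exists s, i s = f y) ->
  exists g : {linear Y -> S}, forall y, i (g y) = f y.
Proof.
move=> ii h.
have [s sE] := choice h.
have lg : linear s by move=> a x y; apply: ii; rewrite linearP !sE linearP.
by have [g gE'] := linear_exists lg; exists g => x; rewrite gE' sE.
Qed.

End SubQuotient.

(** * Finite generation and induction on size, through finite spanning lists over [K] *)

Section Kspan.
Local Open Scope ring_scope.
Variables (K : fieldType) (H : falgType K).
Implicit Types M N X Y Z Q : lmodType H.

(** The [K]-linear span of a list. Modules carry only the action of [H], so a scalar [c] of [K] acts
    as [c%:A]. *)
Fixpoint Kspan (M : lmodType H) (s : seq M) (x : M) : Prop :=
  if s is e :: s' then exists c : K, Kspan s' (x - (c%:A : H) *: e) else x = 0.

Definition Kfinite M := exists s : seq M, forall x, Kspan s x.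

Lemma Kspan0 M (s : seq M) : Kspan s 0.
Proof. by elim: s => //= e s IH; exists 0; rewrite !scale0r subr0. Qed.

Lemma KspanP M (s : seq M) (c : K) x y :
  Kspan s x -> Kspan s y -> Kspan s ((c%:A : H) *: x + y).
Proof.
elim: s x y => [|e s IH] /= x y; first by move=> -> ->; rewrite scaler0 addr0.
move=> [a xs] [b ys]; exists (c * a + b).
have := IH _ _ xs ys; congr Kspan.
by rewrite scalerBr scalerA mulr_algl scalerA !scalerDl opprD addrACA.
Qed.

Lemma KspanD M (s : seq M) x y : Kspan s x -> Kspan s y -> Kspan s (x + y).
Proof. by move=> xs ys; rewrite -[x]scale1r -[1]scale1r; apply: KspanP. Qed.

Lemma KspanZ M (s : seq M) (c : K) x : Kspan s x -> Kspan s ((c%:A : H) *: x).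
Proof. by move=> xs; rewrite -[_ *: _]addr0; apply: KspanP => //; apply: Kspan0. Qed.

Lemma Kspan_cons M (s : seq M) e x : Kspan s x -> Kspan (e :: s) x.
Proof. by exists 0; rewrite scale0r scale0r subr0. Qed.

Lemma Kspan_mem M (s : seq M) x : x \in s -> Kspan s x.
Proof.
elim: s => //= e s IH; rewrite in_cons => /orP[/eqP->|/IH]; last exact: Kspan_cons.
by exists 1; rewrite !scale1r subrr; apply: Kspan0.
Qed.

Lemma Kspan_map M N (f : {linear M -> N}) s x : Kspan s x -> Kspan (map f s) (f x).
Proof.
elim: s x => [|e s IH] x /=; first by move=> ->; rewrite linear0.
by move=> [c /IH]; rewrite linearB linearZ; exists c.
Qed.

(** Gaussian elimination: for each generator [e], either some [p] in [N] has a nonzero coefficient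
    at [e] and clears that coefficient in all other elements, or [e] can be discarded. *)
Lemma Kspan_preim N M (i : {linear N -> M}) s : injective i ->
  exists s', forall n, Kspan s (i n) -> Kspan s' n.
Proof.
move=> ii; elim: s => [|e s [s' IH]].
  by exists [::] => n /= h; apply: ii; rewrite linear0.
have [[p [c [c0 ps]]]|h] :=
    EM (exists p (c : K), c != 0 /\ Kspan s (i p - (c%:A : H) *: e)).
  exists (p :: s') => n /= [d ns]; exists (d / c); apply: IH.
  have := KspanP (- (d / c)) ps ns; congr Kspan.
  rewrite (linearB i) [i (_ *: _)]linearZ /= scalerBr scalerA mulr_algl.
  rewrite scalerA mulNr divfK // !scaleNr opprK.
  by rewrite addrACA subrr addr0 addrC.
exists s' => n /= [c ns]; apply: IH.
have [c0|c0] := eqVneq c 0; first by move: ns; rewrite c0 !scale0r subr0.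
by case: h; exists n, c.
Qed.

Lemma Kspan_ext X Y Z (i : {linear X -> Y}) (p : {linear Y -> Z}) s1 s2 y :
  (forall y, p y = 0 -> exists x, i x = y) -> (forall x, Kspan s1 x) ->
  Kspan (map p s2) (p y) -> Kspan (s2 ++ map i s1) y.
Proof.
move=> ex h1; elim: s2 y => [|e s IH] y /=.
  by move=> /ex[x <-]; apply: Kspan_map.
by move=> [c h]; exists c; apply: IH; rewrite linearB linearZ.
Qed.

Lemma Kspan_quo_lt M Q (p : {linear M -> Q}) s z : Kspan s z -> z <> 0 -> p z = 0 ->
  exists s', (size s' < size s)%N /\ forall x, Kspan s x -> Kspan s' (p x).
Proof.
elim: s z => [|e s IH] z //= [c zs] z0 pz.
have [c0|c0] := eqVneq c 0.
  move: zs; rewrite c0 !scale0r subr0 => zs.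
  have [s' [ss' h]] := IH z zs z0 pz.
  exists (p e :: s'); split=> // x [d /h]; rewrite linearB linearZ.
  by exists d.
exists (map p s); rewrite size_map; split=> // x [d xs].
have pe : Kspan (map p s) (p e).
  have := KspanZ (- c^-1) (Kspan_map p zs); congr Kspan.
  rewrite (linearB p) [p (_ *: _)]linearZ pz /= sub0r scalerN scalerA mulr_algl scalerA.
  by rewrite mulNr mulVf // !scaleNr opprK !scale1r.
have := KspanD (Kspan_map p xs) (KspanZ d pe); congr Kspan.
by rewrite (linearB p) [p (_ *: _)]linearZ subrK.
Qed.

(** The products of a [K]-basis of [H] with the generators span. *)
Lemma fg_Kfinite M : finitely_generated M -> Kfinite M.
Proof.
move=> [n [e eP]].
pose s := [seq b *: e i | b : H <- vbasis {:H}, i <- enum 'I_n].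
exists s => x.
have [c ->] := eP x.
apply: (big_ind (Kspan s)); [exact: Kspan0|exact: KspanD|] => i _.
rewrite (coord_vbasis (memvf (c i))) scaler_suml.
apply: (big_ind (Kspan s)); [exact: Kspan0|exact: KspanD|] => j _.
rewrite -mulr_algl -scalerA; apply/KspanZ/Kspan_mem.
by apply: allpairs_f; rewrite ?mem_enum // mem_nth // size_tuple.
Qed.

Lemma Kfinite_fg M : Kfinite M -> finitely_generated M.
Proof.
move=> [s sP]; exists (size s), (fun i => s`_i) => x; have := sP x.
elim: {sP} s x => [|e s IH] x /=.
  by move=> ->; exists (fun=> 0); rewrite big_ord0.
move=> [c /IH[d dE]].
exists (fun i : 'I_(size s).+1 => if unlift ord0 i is Some j then d j else c%:A).
rewrite big_ord_recl unlift_none /= -[LHS](subrK ((c%:A : H) *: e)) dE addrC.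
by congr (_ + _); apply: eq_bigr => i _; rewrite liftK.
Qed.

(** Here the finite dimension of [H] serves as noetherianity: kernels of maps between finitely
    generated modules stay finitely generated. *)
Lemma fg_sub N M (i : {linear N -> M}) :
  injective i -> finitely_generated M -> finitely_generated N.
Proof.
move=> ii /fg_Kfinite[s sP]; apply: Kfinite_fg.
by have [s' s'P] := Kspan_preim s ii; exists s' => n; apply: s'P.
Qed.

Lemma fg_quo M Q (p : {linear M -> Q}) :
  surjective p -> finitely_generated M -> finitely_generated Q.
Proof.
move=> sp /fg_Kfinite[s sP]; apply: Kfinite_fg.
by exists (map p s) => q; have [x <-] := sp q; apply: Kspan_map.
Qed.

Lemma fg_ext X Y Z (i : {linear X -> Y}) (p : {linear Y -> Z}) :
  (forall y, p y = 0 -> exists x, i x = y) -> surjective p ->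
  finitely_generated X -> finitely_generated Z -> finitely_generated Y.
Proof.
move=> ex sp /fg_Kfinite[s1 h1] /fg_Kfinite[s2 h2]; apply: Kfinite_fg.
have [s ss] : exists s, map p s = s2.
  elim: {h2} s2 => [|z s2 [s <-]]; first by exists [::].
  by have [y <-] := sp z; exists (y :: s).
by exists (s ++ map i s1) => y; apply: (Kspan_ext ex h1); rewrite ss.
Qed.

(* Induction on the dimension over [K], in the only form that is needed:
   a quotient by a nonzero submodule is smaller. *)
Lemma quo_ind (P : fgmod H -> Prop) :
  (forall X : fgmod H,
     (forall (Q : fgmod H) (p : {linear X -> Q}) (z : X),
        surjective p -> z <> 0 -> p z = 0 -> P Q) -> P X) ->
  forall X : fgmod H, P X.
Proof.
(* The measure is the length of any spanning list, not the dimension itself. *)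
move=> IH X; have [s sP] := fg_Kfinite (fgmodP X).
have [n sn] := ubnP (size s).
elim: n X s sP sn => // n IHn X s sP sn; apply: IH => Q p z sp z0 pz.
have [s' [ss' h]] := Kspan_quo_lt (sP z) z0 pz.
apply: (IHn Q s') => [q|]; first by have [x <-] := sp q; apply: h.
exact: leq_trans ss' sn.
Qed.

End Kspan.

(** * Torsion classes, their generation, and semibricks *)

Section Torsion.
Local Open Scope ring_scope.
Variables (K : fieldType) (H : falgType K).
Implicit Types (X Y Z M N Q I : fgmod H) (C S : mod_class H) (T U : tors H).

Section KernelImage.
Variables (X Y : lmodType H) (f : {linear X -> Y}).

Fact lin_kernel0 : f 0 = 0.
Proof. by rewrite linear0. Qed.

Fact lin_kernelP (a : H) x y : f x = 0 -> f y = 0 -> f (a *: x + y) = 0.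
Proof. by move=> fx fy; rewrite linearP fx fy scaler0 addr0. Qed.

Definition lin_kernel : submodule X := Submodule lin_kernel0 lin_kernelP.

Fact lin_image0 : exists x, f x = 0.
Proof. by exists 0; rewrite linear0. Qed.

Fact lin_imageP (a : H) y y' :
  (exists x, f x = y) -> (exists x, f x = y') -> exists x, f x = a *: y + y'.
Proof. by move=> [x <-] [x' <-]; exists (a *: x + x'); rewrite linearP. Qed.

Definition lin_image : submodule Y := Submodule lin_image0 lin_imageP.

End KernelImage.

Lemma ker_exists X (Y : lmodType H) (f : {linear X -> Y}) :
  exists N (i : {linear N -> X}), is_kernel i f.
Proof.
have [N [i [ii iP]]] := sub_exists (lin_kernel f).
by exists (FGMod (fg_sub ii (fgmodP X))), i; split.
Qed.

Lemma coker_exists (X : lmodType H) Y (f : {linear X -> Y}) :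
  exists Q (p : {linear Y -> Q}), is_cokernel f p.
Proof.
have [Q [p [sp pP]]] := quo_exists (lin_image f).
by exists (FGMod (fg_quo sp (fgmodP Y))), p; split.
Qed.

Lemma image_exists X (Y : lmodType H) (f : {linear X -> Y}) :
  exists I (q : {linear X -> I}) (i : {linear I -> Y}),
    [/\ surjective q, injective i & forall x, i (q x) = f x].
Proof.
have [I [i [ii iP]]] := sub_exists (lin_image f).
have [q qE] : exists q : {linear X -> I}, forall x, i (q x) = f x.
  by apply: lin_lift => // x; apply/iP; exists x.
have sq : surjective q.
  move=> n; have [x xn] : lin_image f (i n) by apply/iP; exists n.
  by exists x; apply: ii; rewrite qE.
by exists (FGMod (fg_quo sq (fgmodP X))), q, i.
Qed.

Lemma lin_inj0 (X Y : lmodType H) (f : {linear X -> Y}) :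
  (forall x, f x = 0 -> x = 0) -> injective f.
Proof.
move=> h x y xy; apply/eqP; rewrite -subr_eq0; apply/eqP/h.
by rewrite linearB xy subrr.
Qed.

Lemma inj_lin0 (X Y : lmodType H) (f : {linear X -> Y}) x :
  injective f -> f x = 0 -> x = 0.
Proof. by move=> fi fx; apply: fi; rewrite fx linear0. Qed.

Definition zero_module X := forall x : X, x = 0.

Lemma zero_module_exists : exists Z, zero_module Z.
Proof.
have fgZ : finitely_generated {ffun 'I_0 -> H^o}.
  by exists 0, (fun=> 0) => x; exists (fun=> 0); apply/ffunP => -[].
by exists (FGMod fgZ) => x; apply/ffunP => -[].
Qed.

Lemma torsion_classP C : (exists X, C X) -> quotient_closed C ->
  extension_closed C -> torsion_class C.
Proof.
by move=> C0 Cq Ce; split=> // X Y f [g _ gK]; apply: Cq => y; exists (g y).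
Qed.

Lemma tors_quo T X Y (f : {linear X -> Y}) : surjective f -> T X -> T Y.
Proof. by have [_ _ h _] := torsP T; apply: h. Qed.

Lemma tors_ext T X Y Z (i : {linear X -> Y}) (p : {linear Y -> Z}) :
  short_exact i p -> T X -> T Z -> T Y.
Proof. by have [_ _ _ h] := torsP T; apply: h. Qed.

Lemma tors_zero T Z : zero_module Z -> T Z.
Proof.
move=> Z0; have [[X TX] _ _ _] := torsP T.
by apply: (@tors_quo T X Z \0) => // z; exists 0; rewrite (Z0 z).
Qed.

Definition left_perp C : mod_class H := fun X => forall M, C M -> Hom_zero X M.

Lemma left_perp_torsion C : torsion_class (left_perp C).
Proof.
apply: torsion_classP.
- have [Z Z0] := zero_module_exists.
  by exists Z => M _ f x; rewrite (Z0 x) linear0.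
- move=> X Y f sf XC M CM g y; have [x <-] := sf y.
  exact: (XC M CM (g \o f)).
- move=> X Y Z i p [[_ ip] sp] XC ZC M CM f.
  have [g gE] : exists g : {linear Z -> M}, forall y, g (p y) = f y.
    apply: lin_factor => // y /ip[x <-]; exact: (XC M CM (f \o i)).
  by move=> y; rewrite -gE; exact: (ZC M CM g).
Qed.

Definition tors_perp C : tors H := Tors (left_perp_torsion C).

Lemma tors_meet_torsion (A : tors H -> Prop) :
  torsion_class (fun X => forall U, A U -> U X).
Proof.
apply: torsion_classP.
- have [Z Z0] := zero_module_exists.
  by exists Z => U _; apply: tors_zero.
- by move=> X Y f sf XA U AU; apply: tors_quo sf (XA U AU).
- by move=> X Y Z i p ip XA ZA U AU; apply: tors_ext ip (XA U AU) (ZA U AU).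
Qed.

Lemma tors_join_exists (A : tors H -> Prop) : exists T, is_join (@tors_le K H) A T.
Proof.
pose B U := forall a, A a -> tors_le a U.
exists (Tors (tors_meet_torsion B)); split=> [a Aa X aX U|U AU X]; last by apply.
by move=> /(_ a Aa); apply.
Qed.

(** The torsion class generated by [S], described by its universal property rather than by
    filtrations, so that families and single bricks are treated alike. *)
Definition tors_min (S : mod_class H) T :=
  (forall M, S M -> T M) /\ forall U, (forall M, S M -> U M) -> tors_le T U.

Lemma tors_gen_self M : tors_gen M M.
Proof.
have [Z Z0] := zero_module_exists.
have lev : linear (fun c : {ffun 'I_1 -> M} => c ord0).
  by move=> a x y; rewrite !ffunE.
have [ev evE] := linear_exists lev.
(* A filtration with one step, [M] being a quotient of the sum of one copy of itself. *)
apply: (@Filt_step _ _ _ Z M M \0 (idfun : {linear M -> M})); last 2 first.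
- exact: Filt_zero.
- by exists 1, ev => x; exists [ffun=> x]; rewrite evE ffunE.
split; last by move=> x; exists x.
split; first by move=> x y _; rewrite (Z0 x) (Z0 y).
by move=> x; split=> [/= ->|[n <-]//]; exists 0.
Qed.

(** [Y] is an extension of [Q] by the image of [f], which is a quotient of [X]. *)
Lemma tors_coker_ext T X Y Q (f : {linear X -> Y}) (p : {linear Y -> Q}) :
  is_cokernel f p -> T X -> T Q -> T Y.
Proof.
move=> [sp pP] TX TQ; have [I [q [i [sq ii iq]]]] := image_exists f.
apply: (tors_ext (i := i) (p := p)) (tors_quo sq TX) TQ.
split=> //; split=> // y; rewrite pP; split=> [[x <-]|[z <-]].
  by exists (q x).
by have [x <-] := sq z; exists x.
Qed.

(** By induction on [n]: the cokernel of the first map is covered by the remaining ones, and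
    [tors_coker_ext] applies. *)
Lemma tors_sum T M n X (f : 'I_n -> {linear M -> X}) :
  T M -> (forall x, exists c, x = \sum_i f i (c i)) -> T X.
Proof.
move=> TM; elim: n X f => [|n IH] X f fX.
  by apply: tors_zero => x; have [c ->] := fX x; rewrite big_ord0.
have [Q [p cp]] := coker_exists (f ord0); have [sp pP] := cp.
apply: (tors_coker_ext cp TM); apply: (IH Q (fun j => p \o f (lift ord0 j))) => y.
have [x <-] := sp y; have [c ->] := fX x; exists (fun j => c (lift ord0 j)).
rewrite linear_sum big_ord_recl /= (_ : p _ = 0) ?add0r //.
by apply/pP; exists (c ord0).
Qed.

Lemma tors_Gen T M X : T M -> Gen M X -> T X.
Proof.
move=> TM [n [f sf]].
have lin (i : 'I_n) : linear (fun m : M => [ffun j => if j == i then m else 0]).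
  move=> a x y; apply/ffunP => j; rewrite !ffunE; case: eqP => // _.
  by rewrite scaler0 addr0.
have [e eE] := choice (fun i => linear_exists (lin i)).
apply: (@tors_sum T M n X (fun i => f \o e i)) => // x.
have [c <-] := sf x; exists c; rewrite -linear_sum; congr (f _).
apply/ffunP => j; rewrite sum_ffunE (bigD1 j) //= eE ffunE eqxx big1 ?addr0 //.
by move=> i ij; rewrite eE ffunE eq_sym (negbTE ij).
Qed.

Lemma tors_gen_min T M X : T M -> tors_gen M X -> T X.
Proof.
move=> TM; elim=> {X} [X X0|X Y Z i p ip _ TX XZ]; first exact: tors_zero.
by apply: tors_ext ip TX _; apply: tors_Gen XZ.
Qed.

Lemma tors_min_gen T M : (forall X, T X <-> tors_gen M X) -> tors_min (eq M) T.
Proof.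
move=> TE; split=> [_ <-|U UM X /TE]; first exact/TE/tors_gen_self.
by apply: tors_gen_min; apply: UM.
Qed.

(** The modules whose nonzero quotients all receive a nonzero map from a member of [S] form a
    torsion class containing [S], hence containing [T]. *)
Lemma tors_min_hom S T Y : tors_min S T -> T Y -> ~ zero_module Y ->
  exists M, S M /\ exists f : {linear M -> Y}, ~ (forall x, f x = 0).
Proof.
move=> [_ Tmin] TY Y0.
pose G X := forall Q (q : {linear X -> Q}), surjective q -> ~ zero_module Q ->
  exists M, S M /\ exists f : {linear M -> Q}, ~ (forall x, f x = 0).
have tG : torsion_class G.
  apply: torsion_classP.
  - have [Z Z0] := zero_module_exists.
    exists Z => Q q sq []; move=> y.
    by have [x <-] := sq y; rewrite (Z0 x) linear0.
  - move=> X X' f sf GX Q q sq.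
    by apply: (GX _ (q \o f)) => y; have [x <-] := sq y; have [z <-] := sf x; exists z.
  - move=> X X' Z i p [[_ ip] sp] GX GZ Q q sq Q0.
    (* Either [q] factors through [Z], or the image of [X] in [Q] is a nonzero quotient of [X]. *)
    have [qi0|qi0] := EM (forall x, q (i x) = 0).
      have [g gE] : exists g : {linear Z -> Q}, forall y, g (p y) = q y.
        by apply: lin_factor => // y /ip[x <-].
      by apply: (GZ Q g) => // y; have [x <-] := sq y; exists (p x).
    have [I [r [j [sr ji jr]]]] := image_exists (q \o i).
    have [|M [SM [f f0]]] := GX I r sr.
      by move=> I0; apply: qi0 => x; rewrite -[LHS]jr (I0 (r x)) linear0.
    exists M; split=> //; exists (j \o f) => jf0; apply: f0 => x.
    exact: inj_lin0 ji (jf0 x).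
have GY : Tors tG Y.
  apply: Tmin TY => M SM Q q sq Q0; exists M; split=> //; exists q => q0.
  by apply: Q0 => y; have [x <-] := sq y.
by apply: (GY Y idfun) => // y; exists y.
Qed.

(** The second clause with [M = N] is the brick condition; for nonisomorphic members it is
    Hom-orthogonality. *)
Definition semibrick S :=
  (forall M, S M -> ~ zero_module M) /\
  (forall M N (f : {linear M -> N}), S M -> S N -> ~ (forall x, f x = 0) -> bijective f).

Lemma brick_semibrick M : brick M -> semibrick (eq M).
Proof.
move=> [M0 Minv]; split=> [_ <-//|X Y f MX MY]; move: MX MY f => <- <- f f0.
by have [g [fK gK]] := Minv f f0; exists g.
Qed.

(** By induction on [Y], starting from a nonzero map [h] from some [M'] in [S] to [Y]. If [g \o h]
    is nonzero, it is invertible, and [g] splits. Otherwise [g] factors as [g'] through the cokernel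
    of [h], and the kernel of [g] is an extension of the kernel of [g'] by the image of [h]. *)
Lemma semibrick_epi S T M Y (g : {linear Y -> M}) :
  semibrick S -> tors_min S T -> S M -> T Y -> ~ (forall y, g y = 0) ->
  surjective g /\ forall N (i : {linear N -> Y}), is_kernel i g -> T N.
Proof.
move=> sbS minT SM; elim/(@quo_ind K H): Y g => Y IH g TY g0.
have [|M' [SM' [h h0]]] := tors_min_hom minT TY.
  by move=> Y0; apply: g0 => y; rewrite (Y0 y) linear0.
have [gh0|gh0] := EM (forall x, g (h x) = 0); last first.
  have [k ghK kK] := sbS.2 _ _ (g \o h : {linear M' -> M}) SM' SM gh0.
  have sg : surjective g by move=> m; exists (h (k m)); apply: kK.
  split=> // N i [ii iP].
  have [s sE] : exists s : {linear Y -> M'}, forall y, g (h (s y)) = g y.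
    apply: (lin_lift (i := g \o h)) => [|y]; first exact: can_inj ghK.
    by exists (k (g y)); apply: kK.
  (* The idempotent [1 - h s] projects [Y] onto the kernel of [g], which is thereby a quotient of
     [Y]. *)
  have [r rE] : exists r : {linear Y -> N}, forall y, i (r y) = (idfun \- (h \o s)) y.
    by apply: lin_lift => // y; apply/iP; rewrite /= linearB sE subrr.
  apply: (tors_quo (f := r)) TY => n; exists (i n); apply: ii.
  rewrite rE /=; have gi : g (i n) = 0 by apply/iP; exists n.
  have -> : s (i n) = 0 by apply: (can_inj ghK); rewrite /= sE gi linear0 linear0.
  by rewrite linear0 subr0.
have [Q [p [sp pP]]] := coker_exists h.
have [g' g'E] : exists g' : {linear Q -> M}, forall y, g' (p y) = g y.
  by apply: lin_factor => // y /pP[x <-].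
have [m hm] : exists m, h m <> 0 by apply/existsNP.
have [||sg' kg'] := IH Q p (h m) sp hm _ g' (tors_quo sp TY).
- by apply/pP; exists m.
- by move=> g'0; apply: g0 => y; rewrite -g'E.
split=> [z|N i [ii iP]].
  by have [q <-] := sg' z; have [y <-] := sp q; exists y.
have [N' [i' ki']] := ker_exists g'; have TN' := kg' _ _ ki'; have [ii' iP'] := ki'.
have [I [q [j [sq ji jq]]]] := image_exists h.
have TI : T I by apply: tors_quo sq (minT.1 _ SM').
have [u uE] : exists u : {linear I -> N}, forall x, i (u x) = j x.
  by apply: lin_lift => // x; apply/iP; have [x' <-] := sq x; rewrite jq.
have [v vE] : exists v : {linear N -> N'}, forall x, i' (v x) = (p \o i) x.
  by apply: lin_lift => // x; apply/iP'; rewrite /= g'E; apply/iP; exists x.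
apply: (tors_ext (i := u) (p := v)) TI TN'; split; last first.
  move=> n'; have [y yn'] := sp (i' n').
  have [n nE] : exists n, i n = y by apply/iP; rewrite -g'E yn'; apply/iP'; exists n'.
  by exists n; apply: ii'; rewrite vE /= nE.
split=> [x y xy|n].
  by apply: ji; rewrite -!uE xy.
split=> [vn|[x <-]].
  have /pP[x xn] : p (i n) = 0 by rewrite -[LHS]vE vn linear0.
  by exists (q x); apply: ii; rewrite uE jq.
apply: ii'; rewrite vE /= uE linear0; apply/pP.
by have [x' <-] := sq x; exists x'; rewrite jq.
Qed.

End Torsion.

(** * The map kappa and canonical join representations in the lattice of torsion classes *)

Section Lattice.
Local Open Scope ring_scope.
Variables (K : fieldType) (H : falgType K).
Implicit Types (X Y Z M N Q I : fgmod H) (S : mod_class H) (T U J : tors H).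
Local Notation le := (@tors_le K H).

Lemma is_kappa_uniq J U U' : is_kappa le J U -> is_kappa le J U' -> U = U'.
Proof.
move=> [_ [js [_ h] [k1 k2]]] [_ [js' [c _] [k1' k2']]].
have E := h _ c; subst js'.
by apply: tors_le_anti; [apply: k2'|apply: k2].
Qed.

(** A nonzero map from a module of [U] to [M] is surjective by [semibrick_epi] and would put [M] in
    [U]. *)
Lemma semibrick_perp S T U M : semibrick S -> tors_min S T -> S M ->
  le U T -> ~ U M -> le U (tors_perp (eq M)).
Proof.
move=> sbS minT SM UT UM X UX _ <- f; apply: contrapT => /existsNP[x fx].
have [|sf _] := @semibrick_epi _ _ _ _ _ _ f sbS minT SM (UT _ UX).
  by move=> f0; apply: fx.
by apply: UM; apply: tors_quo sf UX.
Qed.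

Section Brick.
Variables (M : fgmod H) (J : tors H).
Hypotheses (bM : brick M) (minJ : tors_min (eq M) J).

Let JM : J M. Proof. by apply: minJ.1. Qed.
Let sbM := brick_semibrick bM.

Let perpM : ~ tors_perp (eq M) M.
Proof. by move=> /(_ M (erefl _) idfun) /= M0; apply: bM.1. Qed.

(** The element [j_*] covered by [J]. *)
Definition tors_star : tors H :=
  Tors (tors_meet_torsion (fun U => U = J \/ U = tors_perp (eq M))).

Lemma tors_starP X : tors_star X <-> J X /\ tors_perp (eq M) X.
Proof.
split=> [h|[JX pX] _ [->|->]//].
by split; apply: h; [left|right].
Qed.

Lemma tors_star_max U : le U J -> ~ U M -> le U tors_star.
Proof.
move=> UJ UM X UX; apply/tors_starP; split; first exact: UJ.
exact: (semibrick_perp sbM minJ (erefl M) UJ UM).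
Qed.

Let star_lt : strictly_below le tors_star J.
Proof.
split=> [X /tors_starP[]//|E].
by have: tors_star M by [rewrite E]; move=> /tors_starP[_ /perpM].
Qed.

Let below_star U : strictly_below le U J -> le U tors_star.
Proof.
move=> [UJ nUJ]; apply: tors_star_max => // UM; apply: nUJ.
by apply: tors_le_anti => //; apply: minJ.2 => _ <-.
Qed.

Lemma tors_star_lower : is_lower_star le J tors_star.
Proof.
split.
  split=> // U [[sU nsU] /below_star Us].
  exact/nsU/tors_le_anti.
move=> U [UJ hU]; have Us := below_star UJ.
apply: contrapT => nUs; exact: (hU tors_star).
Qed.

(** A nonzero map from [Q] to [M] would give a nonzero, hence invertible, endomorphism of [M] that
    kills the image of [f]. *)
Lemma brick_coker X Q (f : {linear X -> M}) (p : {linear M -> Q}) :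
  ~ (forall x, f x = 0) -> is_cokernel f p -> tors_star Q.
Proof.
move=> f0 [sp pP]; apply/tors_starP; split; first exact: tors_quo sp JM.
move=> _ <- g q; have [m <-] := sp q; apply: contrapT => gpm.
have [|h gpK _] := sbM.2 M M (g \o p : {linear M -> M}) (erefl _) (erefl _).
  by move=> gp0; apply: gpm; apply: gp0.
apply: f0 => x; apply: (can_inj gpK) => /=.
by rewrite (_ : p (f x) = 0) ?linear0 //; apply/pP; exists x.
Qed.

(** Everything strictly below [J] is below [tors_star], hence so is any join of such elements. For
    maximality, if [U] contains [tors_star] and some [X] in [U] maps nontrivially to [M], the
    cokernel of this map is in [tors_star], so [M] is in [U] and [J] lies below [U]. *)
Lemma brick_kappa : is_kappa le J (tors_perp (eq M)).
Proof.
split.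
  move=> A [ubA lubA]; apply: contrapT => nAJ.
  apply: perpM; have /lubA : forall a, A a -> le a (tors_perp (eq M)).
    move=> a Aa X aX; suff /tors_starP[] : tors_star X by [].
    apply: below_star aX; split; first exact: ubA.
    by move=> aJ; apply: nAJ; rewrite -aJ.
  by apply.
exists tors_star; first exact: tors_star_lower.
split=> [|U [sU nJU] X UX _ <- f].
  by split=> [X /tors_starP[]//|/(_ M JM)/perpM].
apply: contrapT => /existsNP[x fx]; apply: nJU; apply: minJ.2 => _ <-.
have [Q [p cp]] := coker_exists f.
by apply: (tors_coker_ext cp UX); apply/sU/(brick_coker _ cp) => f0; apply: fx.
Qed.

End Brick.

(* Let [a] be the join of the remaining elements of the representation.  A
   nonzero map [N -> M] with [N] in [a] makes [M] an extension of a module of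
   [j_*] by a module of [a], so that [{a, j_*}] is an irredundant join
   representation; but [j] lies below neither [a] nor [j_*]. *)
Lemma CJR_hom_zero T (A : tors H -> Prop) J J' M N : is_CJR le T A ->
  A J -> A J' -> J' <> J -> brick M -> tors_min (eq M) J -> J' N ->
  Hom_zero N M.
Proof.
move=> [[joinA irrA] lowA] AJ AJ' JJ' bM minJ JN f.
apply: contrapT => /existsNP[x fx].
pose A' U := A U /\ U <> J.
have [a joina] := tors_join_exists A'.
have [aT naT] : strictly_below le a T.
  by apply: irrA joina => [U []|] //; exists J => // -[].
pose js := tors_star M J.
have [[[sJ nsJ] _] _] := tors_star_lower bM minJ.
have JT : le J T by apply: joinA.1.
have JM : J M by apply: minJ.1.
have nsM : ~ js M.
  by move=> jsM; apply: nsJ; apply: tors_le_anti => //; apply: minJ.2 => _ <-.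
have Jub U : le a U -> le js U -> le J U.
  move=> aU jU; apply: minJ.2 => _ <-.
  have [Q [p cp]] := coker_exists f; apply: (tors_coker_ext cp).
    by apply: aU; apply: (joina.1 J').
  by apply/jU/(brick_coker bM minJ _ cp) => f0; apply: fx.
have Tub U : le a U -> le js U -> le T U.
  move=> aU jU; apply: joinA.2 => U' AU'.
  have [->|nU'] := EM (U' = J); first exact: Jub.
  by move=> X U'X; apply: aU; apply: (joina.1 U').
have /lowA/(_ J AJ)[b [->|->] Jb] :
    irredundant_join_rep le T (fun U => U = a \/ U = js).
- split; first split=> [U [->|->]//|U ubU].
    + by move=> X /sJ /JT.
    + by apply: Tub; apply: ubU; [left|right].
  (* A proper subset omits [a] or [js], so its join lies below the other one, which is strictly
     below [T]. *)
  move=> A'' sA'' [U [->|->] nU] y [uby luby].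
  + have yj : le y js.
      by apply: luby => V AV; case: (sA'' V AV) => [E|-> //]; case: nU; rewrite -E.
    split=> [X /yj /sJ /JT //|yT]; apply: nsM; apply: yj; rewrite yT; exact: JT.
  + have ya : le y a.
      by apply: luby => V AV; case: (sA'' V AV) => [-> //|E]; case: nU; rewrite -E.
    split=> [X /ya /aT //|yT]; apply: naT; apply: tors_le_anti => //; by rewrite -yT.
- apply: naT; apply: tors_le_anti => //; apply: Tub => // X /sJ; exact: Jb.
- exact/nsM/Jb.
Qed.

(** Bricks of distinct members are Hom-orthogonal by [CJR_hom_zero]. A torsion class containing all
    the bricks lies above each member of [A], hence above their join [T]. *)
Lemma CJR_semibrick T (A : tors H -> Prop) (B : tors H -> fgmod H) :
  is_CJR le T A ->
  (forall J, A J -> brick (B J) /\ forall X, J X <-> tors_gen (B J) X) ->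
  semibrick (fun M => exists2 J, A J & M = B J) /\
  tors_min (fun M => exists2 J, A J & M = B J) T.
Proof.
move=> cjr hB; have [[joinA _] _] := cjr.
have minB J : A J -> tors_min (eq (B J)) J by move=> /hB[_]; apply: tors_min_gen.
split; split.
- by move=> _ [J AJ ->]; have [[]] := hB J AJ.
- move=> M N f [J AJ EM'] [J' AJ' EN] f0; subst M N.
  have [E|JJ'] := EM (J = J').
    by subst J'; apply: (brick_semibrick (hB J AJ).1).2 f0.
  case: f0; apply: (CJR_hom_zero cjr AJ' AJ JJ' (hB J' AJ').1 (minB J' AJ')).
  exact: (minB J AJ).1.
- by move=> _ [J AJ ->]; apply: (joinA.1 J AJ); apply: (minB J AJ).1.
- move=> U SU; apply: joinA.2 => J AJ; apply: (minB J AJ).2 => _ <-.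
  by apply: SU; exists J.
Qed.

End Lattice.

(** * The wide subcategory [alpha T] and its filtration by the semibrick *)

Section Alpha.
Local Open Scope ring_scope.
Variables (K : fieldType) (H : falgType K).
Implicit Types (X Y Z M N Q I : fgmod H) (S : mod_class H) (T U J : tors H).

Lemma fst_exists (X Y : lmodType H) :
  exists f : {linear (X * Y)%type -> X}, forall u, f u = u.1.
Proof. exact: linear_exists. Qed.

Lemma snd_exists (X Y : lmodType H) :
  exists f : {linear (X * Y)%type -> Y}, forall u, f u = u.2.
Proof. exact: linear_exists. Qed.

Lemma pair_exists (Z X Y : lmodType H) (f : {linear Z -> X}) (g : {linear Z -> Y}) :
  exists h : {linear Z -> (X * Y)%type}, forall z, h z = (f z, g z).
Proof. by apply: linear_exists => a x y; rewrite !linearP. Qed.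

Lemma fg_prod (X Y : lmodType H) : finitely_generated X -> finitely_generated Y ->
  finitely_generated (X * Y)%type.
Proof.
have [p pE] := snd_exists X Y.
have [i iE] := pair_exists (idfun : {linear X -> X}) (\0 : {linear X -> Y}).
apply: (fg_ext (i := i) (p := p)) => [[x y]|y].
  by rewrite pE /= => ->; exists x; rewrite iE.
by exists (0, y); rewrite pE.
Qed.

Lemma tors_iso_inv T X Y (i : {linear X -> Y}) :
  injective i -> surjective i -> T Y -> T X.
Proof.
move=> ii si.
have [r rE] : exists r : {linear Y -> X},
    forall y, i (r y) = (idfun : {linear Y -> Y}) y.
  exact: lin_lift.
by apply: (tors_quo (f := r)) => x; exists (i x); apply: ii; rewrite rE.
Qed.

Lemma kernel_of_zero T X Y N (g : {linear Y -> X}) (i : {linear N -> Y}) :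
  (forall y, g y = 0) -> is_kernel i g -> T Y -> T N.
Proof. by move=> g0 [ii iP]; apply: tors_iso_inv ii _ => y; apply/iP. Qed.

(** The kernel of [g] is formed in two stages: the kernel [Q] of [p \o g] is in [T] because of [Z],
    and [N] is the kernel of the induced map from [Q] to [X]. *)
Lemma alpha_extension_closed T : extension_closed (alpha T).
Proof.
move=> X Y Z i p ip [TX aX] [TZ aZ]; have [[ii iP] sp] := ip.
split=> [|B g TB N k [ki kP]]; first exact: tors_ext ip TX TZ.
have [Q [q kq]] := ker_exists (p \o g); have [qi qP] := kq.
have [h hE] : exists h : {linear Q -> X}, forall x, i (h x) = (g \o q) x.
  by apply: lin_lift => // x; apply/iP/(qP (q x)); exists x.
have [u uE] : exists u : {linear N -> Q}, forall n, q (u n) = k n.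
  apply: lin_lift => // n; apply/qP => /=.
  by rewrite (_ : g (k n) = 0) ?linear0 //; apply/kP; exists n.
apply: (aX Q h _ N u); first exact: (aZ B (p \o g) TB Q q kq).
split=> [n n' /(congr1 q)|x]; first by rewrite !uE => /ki.
split=> [hx|[n <-]].
  have /kP[n nE] : g (q x) = 0 by rewrite -[LHS]hE hx linear0.
  by exists n; apply: qi; rewrite uE.
by apply: ii; rewrite hE /= uE linear0; apply/kP; exists n.
Qed.

Lemma alpha_kernel_closed T : kernel_closed (alpha T).
Proof.
move=> X Y f [TX aX] [TY aY] N i kf; have [ii iP] := kf.
split=> [|B g TB L k [ki kP]]; first exact: aY TX _ _ kf.
apply: (aX B (i \o g) TB L k); split=> // b.
by rewrite -kP /=; split=> [/(inj_lin0 ii)//|/= ->]; rewrite linear0.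
Qed.

(** Let [P] be the pullback of [p] and [g]. It is an extension of [B] by the image of [f], so it
    lies in [T]; the kernel of its projection to [Y] is the kernel of [g]. *)
Lemma alpha_cokernel_closed T : cokernel_closed (alpha T).
Proof.
move=> X Y f [TX aX] [TY aY] Q p [sp pP].
split=> [|B g TB N k [ki kP]]; first exact: tors_quo sp TY.
have [fs fsE] := fst_exists Y B; have [sn snE] := snd_exists Y B.
(* The pullback is realized as the kernel of the difference of the two maps on the product. *)
have [P [w [wi wP]]] := @ker_exists K H (FGMod (fg_prod (fgmodP Y) (fgmodP B)))
  Q ((p \o fs) \- (g \o sn)).
have wE u : p u.1 = g u.2 <-> exists z, w z = u.
  by rewrite -wP /= fsE snE; split=> [->|/eqP]; rewrite ?subrr // subr_eq0 => /eqP.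
have [I [q [j [sq ij jq]]]] := image_exists f.
have [jp jpE] := pair_exists j (\0 : {linear I -> B}).
have [kp kpE] := pair_exists (\0 : {linear N -> Y}) k.
have pj x : p (j x) = 0 by have [y <-] := sq x; apply/pP; exists y; rewrite jq.
have gk n : g (k n) = 0 by apply/kP; exists n.
have [u uE] : exists u : {linear I -> P}, forall x, w (u x) = jp x.
  by apply: lin_lift => // x; apply/wE; rewrite jpE /= pj linear0.
have [v vE] : exists v : {linear N -> P}, forall x, w (v x) = kp x.
  by apply: lin_lift => // x; apply/wE; rewrite kpE /= linear0 gk.
have TP : T P.
  apply: (@tors_ext _ _ T I P B u (sn \o w)) => //; last exact: tors_quo sq TX.
  split; last first.
    move=> b; have [y yE] := sp (g b); have [z zE] := (wE (y, b)).1 yE.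
    by exists z; rewrite /= snE zE.
  split=> [x x' /(congr1 w)|z]; first by rewrite !uE !jpE => -[/ij].
  rewrite /= snE; split=> [z2|[x <-]]; last by rewrite uE jpE.
  have : p (w z).1 = g (w z).2 by apply/wE; exists z.
  rewrite z2 linear0 => /pP[x xE]; exists (q x); apply: wi.
  by rewrite uE jpE jq xE /= -z2; case: (w z).
apply: (aY P (fs \o w) TP N v); split.
  by move=> n n' /(congr1 w); rewrite !vE !kpE => -[/ki].
move=> z; rewrite /= fsE; split=> [z1|[n <-]]; last by rewrite vE kpE.
have : p (w z).1 = g (w z).2 by apply/wE; exists z.
rewrite z1 linear0 => /esym/kP[n nE]; exists n; apply: wi.
by rewrite vE kpE nE /= -z1; case: (w z).
Qed.

Lemma alpha_wide T : wide_subcategory (alpha T).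
Proof.
split; [|exact: alpha_extension_closed|exact: alpha_kernel_closed
        |exact: alpha_cokernel_closed].
have [Z Z0] := zero_module_exists H.
exists Z; split=> [|Y g TY N i ki]; first exact: tors_zero.
by apply: kernel_of_zero _ ki TY => y; apply: Z0.
Qed.

Lemma semibrick_alpha S T M : semibrick S -> tors_min S T -> S M -> alpha T M.
Proof.
move=> sbS minT SM; split=> [|Y g TY N i ki]; first exact: minT.1.
have [g0|g0] := EM (forall y, g y = 0); first exact: kernel_of_zero g0 ki TY.
by have [_ h] := semibrick_epi sbS minT SM TY g0; apply: h ki.
Qed.

(** The kernel of [f] lies in [T] since [N] is in [alpha T]. Were it nonzero, its inclusion into [M]
    would be surjective by [semibrick_epi], and [f] would vanish. *)
Lemma semibrick_mono S T M N (f : {linear M -> N}) :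
  semibrick S -> tors_min S T -> S M -> alpha T N ->
  ~ (forall x, f x = 0) -> injective f.
Proof.
move=> sbS minT SM [_ aN] f0; apply: lin_inj0 => x fx.
have [L [k kf]] := ker_exists f; have [ki kP] := kf.
have TL : T L by apply: aN kf; apply: minT.1.
have /kP[n <-] := fx; apply: contrapT => kn.
have [|sk _] := @semibrick_epi _ _ _ _ _ _ k sbS minT SM TL.
  by move=> k0; apply: kn.
by apply: f0 => y; apply/kP; exact: sk.
Qed.

(** Every nonzero [N] in [alpha T] contains a member of [S], and the quotient is again in [alpha T];
    thus [alpha T] is filtered by [S]. *)
Lemma alpha_ind S T (P : mod_class H) : semibrick S -> tors_min S T ->
  (forall Z, zero_module Z -> P Z) ->
  (forall M N Q (i : {linear M -> N}) (p : {linear N -> Q}),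
     S M -> short_exact i p -> P Q -> P N) ->
  forall N, alpha T N -> P N.
Proof.
move=> sbS minT P0 PS; elim/(@quo_ind K H) => N IH aN.
have [N0|N0] := EM (zero_module N); first exact: P0.
have [M [SM [f f0]]] := tors_min_hom minT aN.1 N0.
have fi := semibrick_mono sbS minT SM aN f0.
have [Q [p kp]] := coker_exists f; have [sp pP] := kp.
have aM := semibrick_alpha sbS minT SM.
apply: (PS _ _ _ f p SM); first by split.
have [x fx] : exists x, f x <> 0 by apply/existsNP.
apply: (IH Q p (f x) sp fx); first by apply/pP; exists x.
exact: (alpha_cokernel_closed aM aN kp).
Qed.

(** Together with [semibrick_alpha], this identifies the left perpendicular classes of [S] and of
    [alpha T]. *)
Lemma Hom_zero_alpha S T X : semibrick S -> tors_min S T ->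
  (forall M, S M -> Hom_zero X M) -> forall N, alpha T N -> Hom_zero X N.
Proof.
move=> sbS minT XS; apply: (alpha_ind sbS minT) => [Z Z0 f x|]; first exact: Z0.
move=> M N Q i p SM [[ii iP] _] XQ f.
have [g gE] : exists g : {linear X -> M}, forall x, i (g x) = f x.
  by apply: lin_lift => // x; apply/iP; apply: (XQ (p \o f)).
by move=> x; rewrite -gE (XS M SM g) linear0.
Qed.

End Alpha.

(** * Vanishing of [Ext^1], heredity, and [alpha] of the left perpendicular class *)

Section Ext.
Local Open Scope ring_scope.
Variables (K : fieldType) (H : falgType K).
Implicit Types (X Y Z M N Q I E : fgmod H) (S : mod_class H) (T U J : tors H).

(** The retraction is the first component of [phi]; conversely [phi] is the pair of [r] and [p]. *)
Lemma Ext1_zeroP X M : Ext1_zero X M <->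
  forall E (i : {linear M -> E}) (p : {linear E -> X}), short_exact i p ->
    exists r : {linear E -> M}, forall m, r (i m) = m.
Proof.
split=> h E i p ip.
  have [phi [phi1 phi2]] := h E i p ip; have [f fE] := fst_exists M X.
  by exists (f \o phi) => m; rewrite /= fE phi1.
have [r rE] := h E i p ip; have [phi phiE] := pair_exists r p.
exists phi; split=> [m|e]; rewrite phiE // rE; congr (_, _).
by have [[_ iP] _] := ip; apply/iP; exists m.
Qed.

(** The maps [f i] embed [P] in a free module of rank [n]. The image of the first coordinate is a
    left ideal, hence projective, so [P] splits as this ideal plus the kernel, which embeds in rank
    one less. *)
Lemma hereditary_projective n (P : lmodType H) (f : 'I_n -> {linear P -> H^o}) :
  hereditary H -> (forall x, (forall i, f i x = 0) -> x = 0) -> projective P.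
Proof.
move=> hH; elim: n P f => [|n IH] P f f0 X Y g u sg.
  have P0 (x : P) : x = 0 by apply: f0 => -[].
  by exists \0 => x; rewrite (P0 x) !linear0.
have [I [j [ij jP]]] := sub_exists (lin_image (f ord0)).
have [q qE] : exists q : {linear P -> I}, forall x, j (q x) = f ord0 x.
  by apply: lin_lift => // x; apply/jP; exists x.
have sq : surjective q.
  move=> y; have [x xE] : lin_image (f ord0) (j y) by apply/jP; exists y.
  by exists x; apply: ij; rewrite qE.
have projI : projective I := hH I j ij.
have [s sE] := projI P I q idfun sq.
have [P' [w [wi wP]]] := sub_exists (lin_kernel q).
have projP' : projective P'.
  apply: (IH P' (fun i => f (lift ord0 i) \o w)) => x h; apply: wi; rewrite linear0.
  apply: f0 => i; have [i' ->|->] := unliftP ord0 i; first exact: h.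
  by rewrite -qE (_ : q (w x) = 0) ?linear0 //; apply/wP; exists x.
have [t tE] : exists t : {linear P -> P'}, forall x, w (t x) = (idfun \- (s \o q)) x.
  by apply: lin_lift => // x; apply/wP; rewrite /= linearB sE subrr.
have [h1 h1E] := projI X Y g (u \o s) sg.
have [h2 h2E] := projP' X Y g (u \o w) sg.
exists ((h1 \o q) \+ (h2 \o t)) => x.
by rewrite /= linearD h1E h2E /= tE /= linearB addrC subrK.
Qed.

(* The pushout of the sequence along [f] splits. *)
Lemma Ext1_zero_extend X M (G Y : lmodType H) (k : {linear G -> Y})
    (q : {linear Y -> X}) (f : {linear G -> M}) :
  short_exact k q -> Ext1_zero X M ->
  exists h : {linear Y -> M}, forall x, h (k x) = f x.
Proof.
move=> [[ki kP] sq] /Ext1_zeroP extX.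
have qk x : q (k x) = 0 by apply/kP; exists x.
have [fk fkE] := pair_exists f (\0 \- k).
(* The pushout of [f] and [k], as the quotient of the product by the pairs [(f x, - k x)]. *)
have [D [d [sd dP]]] := quo_exists (lin_image fk).
have [sn snE] := snd_exists M Y.
have [p pE] : exists p : {linear D -> X}, forall x, p (d x) = (q \o sn) x.
  apply: lin_factor => // x /dP[n <-].
  by rewrite /= snE fkE /= sub0r linearN qk oppr0.
have [inl inlE] := pair_exists (idfun : {linear M -> M}) (\0 : {linear M -> Y}).
have [inr inrE] := pair_exists (\0 : {linear Y -> M}) (idfun : {linear Y -> Y}).
have dk x : d (inr (k x)) = d (inl (f x)).
  apply/eqP; rewrite eq_sym -subr_eq0 -linearB; apply/eqP/dP; exists x.
  by rewrite fkE inrE inlE; congr (_, _); rewrite /= ?subr0.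
have pP x : p x = 0 <-> exists m, (d \o inl) m = x.
  split=> [|[m <-]]; last by rewrite /= pE /= snE inlE linear0.
  have [[m y] <-] := sd x; rewrite pE /= snE /= => /kP[n nE].
  exists (m + f n); rewrite /= (linearD inl) (linearD d) -dk nE -(linearD d).
  by congr (d _); rewrite inlE inrE; congr (_, _); rewrite /= ?addr0 ?add0r.
have sp : surjective p.
  by move=> x; have [y <-] := sq x; exists (d (inr y)); rewrite pE /= snE inrE.
have fgD : finitely_generated D.
  by apply: (fg_ext (i := d \o inl) (p := p)) (fgmodP M) (fgmodP X) => // x /pP.
have [|r rE] := extX (FGMod fgD) (d \o inl) p.
  split=> //; split=> //; apply: lin_inj0 => m /dP[n]; rewrite fkE inlE => -[<-].
  rewrite /= sub0r => /eqP; rewrite oppr_eq0 => /eqP nk.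
  by rewrite (_ : n = 0) ?linear0 //; apply: ki; rewrite nk linear0.
by exists (r \o (d \o inr)) => x; rewrite /= dk rE.
Qed.

(* Heredity enters as the vanishing of [Ext^2]: [Ext^1(-, M)] is right exact. *)
Lemma Ext1_zero_sub X I M (j : {linear I -> X}) :
  hereditary H -> injective j -> Ext1_zero X M -> Ext1_zero I M.
Proof.
move=> hH ij extX; apply/Ext1_zeroP => E i p [[ii iP] sp].
have [n [e eP]] := fgmodP X; pose F : lmodType H := {ffun 'I_n -> H^o}.
have lpi : linear (fun c : F => \sum_k (c k : H) *: e k).
  move=> a c d; rewrite scaler_sumr -big_split; apply: eq_bigr => k _.
  by rewrite !ffunE scalerDl scalerA.
have [q qE] := linear_exists lpi.
have sq : surjective q.
  move=> x; have [c ->] := eP x; exists [ffun k => c k]; rewrite qE.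
  by apply: eq_bigr => k _; rewrite ffunE.
have s0 : exists y, j y = q 0 by exists 0; rewrite !linear0.
have sP (a : H) c d : (exists y, j y = q c) -> (exists y, j y = q d) ->
    exists y, j y = q (a *: c + d).
  by move=> [y yE] [z zE]; exists (a *: y + z); rewrite !linearP yE zE.
(* [FI] is the preimage of [I] in the free cover [F] of [X]. It maps onto [I] by [v] and is
   projective by heredity, so that [v] lifts to [w : FI -> E]. *)
have [FI [u [ui uP]]] := sub_exists (Submodule s0 sP).
have [v vE] : exists v : {linear FI -> I}, forall x, j (v x) = (q \o u) x.
  by apply: lin_lift => // x; apply/(uP (u x)); exists x.
have sv : surjective v.
  move=> y; have [c cE] := sq (j y).
  have /uP[x xE] : exists y', j y' = q c by exists y.
  by exists x; apply: ij; rewrite vE /= xE cE.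
have projFI : projective FI.
  have lc k : linear (fun x : FI => (u x : F) k : H^o).
    by move=> a x y; rewrite linearP !ffunE.
  have [f fE] := choice (fun k => linear_exists (lc k)).
  apply: (@hereditary_projective n FI f hH) => x x0; apply: ui; rewrite linear0.
  by apply/ffunP => k; rewrite -fE x0 ffunE.
have [w wE] := projFI E I p v sp.
have [G [k [ki kerP]]] := sub_exists (lin_kernel q).
have qk x : q (k x) = 0 by apply/kerP; exists x.
have [k' k'E] : exists k' : {linear G -> FI}, forall x, u (k' x) = k x.
  by apply: lin_lift => // x; apply/uP; exists 0; rewrite linear0 qk.
have vk x : v (k' x) = 0 by apply: ij; rewrite vE /= k'E qk linear0.
(* [G] is the kernel of both [q] and [v], so [w] maps it into [M]; as [Ext^1(X, M) = 0], this map
   [s] extends to all of [F]. *)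
have [s sE] : exists s : {linear G -> M}, forall x, i (s x) = (w \o k') x.
  by apply: lin_lift => // x; apply/iP; rewrite /= wE vk.
have [h hE] : exists h : {linear F -> M}, forall x, h (k x) = s x.
  exact: (Ext1_zero_extend (q := q)).
(* Subtracting the extension makes [w] vanish on [G], so that it descends to a section of [p]. *)
have [t tE] : exists t : {linear I -> E}, forall x, t (v x) = (w \- (i \o (h \o u))) x.
  apply: lin_factor => // x vx.
  have /kerP[y yE] : q (u x) = 0 by rewrite -[LHS]vE vx linear0.
  have xE : x = k' y by apply: ui; rewrite k'E.
  by rewrite xE /= k'E hE sE subrr.
have pt y : p (t y) = y.
  have [x <-] := sv y; rewrite tE /= linearB wE.
  by rewrite (_ : p (i _) = 0) ?subr0 //; apply/iP; eexists.
have pi m : p (i m) = 0 by apply/iP; exists m.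
have [r' r'E] : exists r' : {linear E -> M}, forall x, i (r' x) = (idfun \- (t \o p)) x.
  by apply: lin_lift => // x; apply/iP; rewrite /= linearB pt subrr.
by exists r' => m; apply: ii; rewrite r'E /= pi linear0 subr0.
Qed.

(** The pushout [E1] of the extension along [b] splits by [r1]. The kernel [E'] of [r1 \o c] is then
    an extension of [X] by [M], which splits by [r2], and the two splittings combine. *)
Lemma Ext1_zero_ext X M N Q (a : {linear M -> N}) (b : {linear N -> Q}) :
  short_exact a b -> Ext1_zero X M -> Ext1_zero X Q -> Ext1_zero X N.
Proof.
move=> [[ai aP] sb] /Ext1_zeroP extM /Ext1_zeroP extQ.
apply/Ext1_zeroP => E i p [[ii iP] sp].
have pi n : p (i n) = 0 by apply/iP; exists n.
have ba m : b (a m) = 0 by apply/aP; exists m.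
have [E1 [c [sc cP]]] := coker_exists (i \o a).
have [i1 i1E] : exists i1 : {linear Q -> E1}, forall n, i1 (b n) = (c \o i) n.
  by apply: lin_factor => // n /aP[m <-]; apply/cP; exists m.
have [p1 p1E] : exists p1 : {linear E1 -> X}, forall e, p1 (c e) = p e.
  by apply: lin_factor => // e /cP[m <-]; apply: pi.
have [|r1 r1E] := extQ E1 i1 p1.
  split; last by move=> x; have [e <-] := sp x; exists (c e).
  split.
    apply: lin_inj0 => x; have [n <-] := sb x; rewrite i1E => /cP[m /ii <-].
    exact: ba.
  move=> x; have [e <-] := sc x; rewrite p1E iP.
  split=> [[n <-]|[y]]; first by exists (b n); rewrite i1E.
  have [n <-] := sb y; rewrite i1E => /= E0.
  have /cP[m mE] : c (e - i n) = 0 by rewrite linearB E0 subrr.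
  by exists (a m + n); rewrite linearD -[i (a m)]/((i \o a) m) mE subrK.
have r1b n : r1 (c (i n)) = b n by rewrite -[c _]/((c \o i) n) -i1E r1E.
have [E' [k [ki kP]]] := ker_exists (r1 \o c).
have [i2 i2E] : exists i2 : {linear M -> E'}, forall m, k (i2 m) = (i \o a) m.
  by apply: lin_lift => // m; apply/kP; rewrite /= r1b.
have key e' n : k e' = i n -> exists2 m, n = a m & e' = i2 m.
  move=> E0; have /aP[m mE] : b n = 0 by rewrite -r1b -E0; apply/kP; exists e'.
  by exists m => //; apply: ki; rewrite i2E /= mE.
have [|r2 r2E] := extM E' i2 (p \o k).
  split; last first.
    move=> x; have [e <-] := sp x; have [n nE] := sb (r1 (c e)).
    have /kP[e' e'E] : (r1 \o c) (e - i n) = 0.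
      by rewrite /= !linearB r1b nE subrr.
    by exists e'; rewrite /= e'E linearB pi subr0.
  split.
    by apply: lin_inj0 => m E0; apply: ai; apply: ii; rewrite -[LHS]i2E E0 !linear0.
  move=> e'; split=> [/iP[n /esym/key[m _ ->]]|[m <-]]; first by exists m.
  by rewrite /= i2E /= pi.
have [fs fsE] := fst_exists E' N; have [sn snE] := snd_exists E' N.
(* [E] is the sum of [E'] and [N], which meet in [M]; the maps [a \o r2] and the identity agree
   there and glue. *)
have [r rE] : exists r : {linear E -> N}, forall x,
    r (((k \o fs) \+ (i \o sn)) x) = ((a \o (r2 \o fs)) \+ sn) x.
  apply: lin_factor => [e|[e' n]] /=.
    have [n nE] := sb (r1 (c e)).
    have /kP[e' e'E] : (r1 \o c) (e - i n) = 0.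
      by rewrite /= !linearB r1b nE subrr.
    by exists (e', n); rewrite /= fsE snE /= e'E subrK.
  rewrite fsE snE /= => /eqP; rewrite addr_eq0 -linearN => /eqP/key[m nE ->].
  by rewrite r2E -nE addNr.
exists r => n; have := rE (0, n).
by rewrite /= fsE snE /= !linear0 !add0r.
Qed.

Lemma Ext1_zero_mod0 X Z : zero_module Z -> Ext1_zero X Z.
Proof.
move=> Z0; apply/Ext1_zeroP => E i p _; exists \0 => z.
by rewrite (Z0 z).
Qed.

Lemma alpha_perp_Ext S T X M : semibrick S -> tors_min S T -> S M ->
  alpha (tors_perp (alpha T)) X -> Ext1_zero X M.
Proof.
set U := tors_perp _ => sbS minT SM [UX aX].
apply/Ext1_zeroP => E i p ip; have [[ii iP] sp] := ip.
have aM := semibrick_alpha sbS minT SM.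
(* As [X] is in [alpha U], [E] in [U] would force its submodule [M] into [U], against the identity
   of [M]. *)
have nUE : ~ U E.
  move=> UE; have /(_ M aM idfun) /= M0 : U M := aX E p UE M i ip.1.
  exact: (sbS.1 M SM).
have [N [aN [f f0]]] : exists N, alpha T N /\
    exists f : {linear E -> N}, ~ (forall x, f x = 0).
  apply: contrapT => nex; apply: nUE => N aN f; apply: contrapT => fx.
  apply: nex; exists N; split=> //; exists f => f0.
  by apply: fx => x; apply: f0.
have fi0 : ~ (forall m, (f \o i) m = 0).
  move=> fi0; have [g gE] : exists g : {linear X -> N}, forall e, g (p e) = f e.
    by apply: lin_factor => // e /iP[m <-]; apply: fi0.
  by apply: f0 => e; rewrite -gE; apply: (UX N aN g).
have fii := semibrick_mono sbS minT SM aN fi0.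
have [Q [q kq]] := coker_exists (f \o i); have [sq qP] := kq.
have aQ := alpha_cokernel_closed aM aN kq.
(* The induced map from [X] in [U] to [Q] in [alpha T] is zero, so [f] takes values in the copy of
   [M] in [N], and this gives the retraction. *)
have [g gE] : exists g : {linear X -> Q}, forall e, g (p e) = (q \o f) e.
  by apply: lin_factor => // e /iP[m <-]; apply/qP; exists m.
have [r rE] : exists r : {linear E -> M}, forall e, (f \o i) (r e) = f e.
  by apply: lin_lift => // e; apply/qP; rewrite -[LHS]gE; apply: (UX Q aQ g).
by exists r => m; apply: fii; exact: rE.
Qed.

Lemma alpha_perp S T X : hereditary H -> semibrick S -> tors_min S T ->
  alpha (tors_perp (alpha T)) X <-> epsilon_wide (alpha T) X.
Proof.
move=> hH sbS minT; split=> [aX M aM|eX].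
  split; first exact: aX.1.
  move: M aM; apply: (alpha_ind sbS minT) => [Z|M N Q i p SM ip].
    exact: Ext1_zero_mod0.
  by apply: Ext1_zero_ext ip (alpha_perp_Ext sbS minT SM aX).
split=> [M /eX[]//|Y g UY N k [ki kP] M aM f].
have [homX extX] := eX M aM.
have [I [q [j [sq ij jq]]]] := image_exists g.
have kq : short_exact k q.
  split=> //; split=> // y; rewrite -kP -jq.
  by split=> [->|/(inj_lin0 ij)//]; rewrite linear0.
(* [f] extends from [N] to [Y], and every map from [Y] to [M] vanishes. *)
have [h hE] := Ext1_zero_extend f kq (Ext1_zero_sub hH ij extX).
by move=> n; rewrite -hE; apply: (UY M aM h).
Qed.

End Ext.

Theorem theoremD (K : fieldType) (H : falgType K) (hH : hereditary H)
    (T : tors H) (hT : tors0 T) :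
  exists U : tors H,
    is_kappa_bar (@tors_le K H) T U /\
    [/\ wide_subcategory (alpha T), wide_subcategory (alpha U)
      & forall X : fgmod H, alpha U X <-> epsilon_wide (alpha T) X].
Proof.
have [A cjr bricks] := hT.
(* [Z] is the default value of the choice function [B] outside [A]. *)
have [Z _] := zero_module_exists H.
have [B hB] : exists B : tors H -> fgmod H, forall J, A J ->
    brick (B J) /\ forall X, J X <-> tors_gen (B J) X.
  have /choice[B hB] : forall J : tors H, exists M,
      A J -> brick M /\ forall X, J X <-> tors_gen M X.
    move=> J; have [/bricks[M bM JM]|nA] := EM (A J); last by exists Z.
    by exists M.
  by exists B.
have [sbS minT] := CJR_semibrick cjr hB.
have kB J : A J -> is_kappa (@tors_le K H) J (tors_perp (eq (B J))).
  by move=> /hB[bJ JB]; apply: brick_kappa bJ _; apply: tors_min_gen.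
(* Taking the perpendicular of [alpha T] instead of the bricks suits [alpha_perp]; [Hom_zero_alpha]
   then shows that it is still the meet of the kappas. *)
exists (tors_perp (alpha T)); split; last first.
  by split; [exact: alpha_wide|exact: alpha_wide|move=> X; apply: alpha_perp hH sbS minT].
exists A => //; split=> [J AJ|]; first by exists (tors_perp (eq (B J))); apply: kB.
split=> [k [J AJ kJ]|V Vk X VX].
  rewrite (is_kappa_uniq kJ (kB J AJ)) => X UX _ <-.
  by apply/UX/(semibrick_alpha sbS minT); exists J.
apply: (Hom_zero_alpha sbS minT) => _ [J AJ ->].
apply: (Vk (tors_perp (eq (B J))) _ X VX) (erefl _).
by exists J => //; apply: kB.
Qed.
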